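(* Let $(V,\mathcal{J})$ be a finite-dimensional real vector space with a linear generalized complex structure with classical tensors $(A,\pi,\sigma)$, let $f_*:V\to W$ be a linear surjection such that the projected generalized complex structure $\tilde{\mathcal{J}}$ of $W$ exists, and identify $W^*$ with $\mathrm{ann}(\ker f_* )\subseteq V^*$. Let $B=V\oplus W^*\subseteq\mathbf V$ and let $q:B\to B/\ker f_*=\mathbf{W}$ be the projection. For any pair $\mathcal{X}=(X,\alpha)\in B$, consider decompositions $$A^*\alpha=\flat_\sigma Z+\nu,\qquad X=Z'+U,\qquad \mathcal{J}\mathcal{X}=\mathcal{X}'+\mathcal{J}\mathcal{X}_0,$$ where $Z,Z'\in\ker f_*$, $U\in\mathrm{ann}(\flat_\sigma(\ker f_* ))$, $\nu\in W^*$, $\mathcal{X}'\in B$ and $\mathcal{X}_0\in\ker f_*$ (such decompositions exist when $\tilde{\mathcal J}$ exists). Then $$\tilde{\mathcal{J}}(q(X,\alpha))=q(\mathcal{J}(U+Z,\alpha)),$$ and also $$\tilde{\mathcal{J}}(q\mathcal{X})=q(\mathcal{X}')=q(\mathcal{J}(\mathcal{X}-\mathcal{X}_0)).$$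
   Context: For a finite-dimensional real vector space $V$ put $\mathbf{V}=V\oplus V^*$ with the neutral metric $g((X,\alpha),(Y,\mu))=\frac12(\alpha(Y)+\mu(X))$; the superscript $c$ denotes complexification. A linear generalized complex structure on $V$ is $\mathcal{J}\in\mathrm{End}(\mathbf V)$ with $\mathcal{J}^2=-\mathrm{Id}$ and $g(\mathcal{X},\mathcal{J}\mathcal{Y})+g(\mathcal{J}\mathcal{X},\mathcal{Y})=0$; it can be written $\mathcal{J}(X,\alpha)=(AX+\sharp_\pi\alpha,\flat_\sigma X-A^*\alpha)$ with $A\in\mathrm{End}(V)$, $\pi\in\wedge^2V$, $\sigma\in\wedge^2V^*$, $\sharp_\pi\alpha=i(\alpha)\pi$, $\flat_\sigma X=i(X)\sigma$, $A^*$ the transpose of $A$. It is equivalent to its $i$-eigenspace $L\subset\mathbf V^c$, a maximal $g$-isotropic subspace with $L\cap\bar L=0$. A subspace of $V$ (e.g. $\ker f_*$) is regarded as a subspace of $\mathbf V$ via $X\mapsto(X,0)$, and $\mathrm{ann}$ denotes annihilator (for a subspace of $V^*$, its annihilator in $V$). For a linear map $f_*:V\to W$ with transpose $f^*:W^*\to V^*$, the push-forward of a subspace $S$ of $\mathbf V$ (or $\mathbf V^c$) is $\overrightarrow f_*S=\{(f_*X,\eta):(X,f^*\eta)\in S,\ X\in V,\ \eta\in W^*\}$ (complexified where needed). The surjection $f_*:(V,\mathcal J)\to W$ has image with projected structure if $\overrightarrow f_*L\cap\overrightarrow f_*\bar L=0$; then $\overrightarrow f_*L$ is the $i$-eigenspace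 of a linear generalized complex structure $\tilde{\mathcal J}$ on $W$, the projected structure. The projection $q$ is $q(X,f^*\eta)=(f_*X,\eta)$. *)

(* Defs.v *)
From HB Require Import structures.
From mathcomp Require Import all_boot all_order all_algebra.
From mathcomp Require Import complex.

Set Implicit Arguments.
Unset Strict Implicit.
Unset Printing Implicit Defensive.

Import Num.Theory GRing.Theory VectorInternalTheory.
Local Open Scope ring_scope.
Local Open Scope complex_scope.

Section Complexification.
Variable R : rcfType.

(* The pair (u, v) stands for u + i v. *)
Definition complexification (V : vectType R) : Type := (V * V)%type.

Section Structure.
Variable V : vectType R.
Local Notation VC := (complexification V).

HB.instance Definition _ := GRing.Zmodule.copy VC (V * V)%type.

Definition cscale (a : R[i]) (z : VC) : VC :=
  (complex.Re a *: z.1 - complex.Im a *: z.2,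
   complex.Re a *: z.2 + complex.Im a *: z.1).

Fact cscaleA a b z : cscale a (cscale b z) = cscale (a * b) z.
Proof.
case: a b z => [a1 a2] [b1 b2] [u v]; rewrite /cscale /=.
rewrite !scalerBr !scalerDr !scalerA !scalerBl !scalerDl !opprD.
by congr pair; rewrite [X in _ + X]addrC addrACA.
Qed.

Fact cscale1 : left_id 1 cscale.
Proof. by case=> u v; rewrite /cscale /= !scale1r !scale0r subr0 addr0. Qed.

Fact cscaleDr : right_distributive cscale +%R.
Proof.
move=> a [u v] [u' v']; rewrite /cscale /=; congr pair.
  by rewrite !scalerDr opprD addrACA.
by rewrite !scalerDr addrACA.
Qed.

Fact cscaleDl z : {morph cscale^~ z : a b / a + b}.
Proof.
case: z => u v [a1 a2] [b1 b2]; rewrite /cscale /=; congr pair.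
  by rewrite !scalerDl opprD addrACA.
by rewrite !scalerDl addrACA.
Qed.

HB.instance Definition _ :=
  GRing.Zmodule_isLmodule.Build R[i] VC cscaleA cscale1 cscaleDr cscaleDl.

Fact complexification_vect_iso : Vector.axiom (dim V) VC.
Proof.
exists (fun z : VC => \row_j (v2r z.1 0 j +i* v2r z.2 0 j)).
  move=> a z z'; apply/rowP=> j; case: a => a1 a2.
  rewrite !mxE /= /cscale /= !(linearD, linearN, linearZ) /= !mxE mulrN.
  by [].
exists (fun r : 'rV_(dim V) =>
   (r2v (map_mx (@complex.Re R) r), r2v (map_mx (@complex.Im R) r)) : VC).
  move=> [u v] /=; congr pair; apply: (can_inj v2rK); rewrite r2vK;
    by apply/rowP=> j; rewrite !mxE.
by move=> r; apply/rowP=> j; rewrite mxE /= !r2vK !mxE; case: (r 0 j).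
Qed.

HB.instance Definition _ :=
  Lmodule_hasFinDim.Build R[i] VC complexification_vect_iso.

Lemma complexification_scaleE (a : R[i]) (z : VC) :
  a *: z = (complex.Re a *: z.1 - complex.Im a *: z.2,
            complex.Re a *: z.2 + complex.Im a *: z.1) :> VC.
Proof. by []. Qed.

Lemma complexification_addE (z z' : VC) :
  z + z' = (z.1 + z'.1, z.2 + z'.2) :> VC.
Proof. by []. Qed.

End Structure.

Section Maps.
Implicit Types U V : vectType R.

Definition conj_vec V (z : complexification V) : complexification V :=
  (z.1, - z.2).

(* Conjugation is not C-linear, so the conjugate subspace is given by
   conjugating a basis; see memv_conj_space. *)
Definition conj_space V (S : {vspace complexification V}) :
    {vspace complexification V} :=
  <<[seq conj_vec z | z <- vbasis S]>>%VS.

Definition complexify_fun U V (f : 'Hom(U, V)) (z : complexification U) :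
  complexification V := (f z.1, f z.2).

Fact complexify_fun_is_linear U V (f : 'Hom(U, V)) :
  linear (complexify_fun f).
Proof.
move=> a z z'; rewrite /complexify_fun !complexification_addE.
rewrite !complexification_scaleE /=.
by congr pair; rewrite !(linearD, linearN, linearZ) /=.
Qed.

HB.instance Definition _ U V (f : 'Hom(U, V)) :=
  GRing.isLinear.Build R[i] (complexification U) (complexification V) _
    (complexify_fun f) (complexify_fun_is_linear f).

Definition complexify U V (f : 'Hom(U, V)) :
    'Hom(complexification U, complexification V) :=
  linfun (complexify_fun f).

Lemma complexifyE U V (f : 'Hom(U, V)) z : complexify f z = (f z.1, f z.2).
Proof. by rewrite lfunE. Qed.

Lemma conj_vecK V : involutive (@conj_vec V).
Proof. by case=> u v; rewrite /conj_vec /= opprK. Qed.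

Lemma conj_vecD V : {morph @conj_vec V : z z' / z + z'}.
Proof.
by move=> z z'; rewrite /conj_vec !complexification_addE /= opprD.
Qed.

Lemma conj_vecZ V (a : R[i]) (z : complexification V) :
  conj_vec (a *: z) = conjc a *: conj_vec z.
Proof.
case: a => a1 a2; rewrite /conj_vec !complexification_scaleE /=.
by congr pair; rewrite ?scalerN ?scaleNr ?opprK // opprD.
Qed.

Lemma memv_conj_space V (S : {vspace complexification V}) z :
  (z \in conj_space S) = (conj_vec z \in S).
Proof.
have conj_span (X : seq (complexification V))
    (T : {vspace complexification V}) :
    {in X, forall y, conj_vec y \in T} ->
    {in <<X>>%VS, forall y, conj_vec y \in T}.
  move=> XT y /(@coord_span _ _ _ (in_tuple X)) ->.
  rewrite (big_morph _ (@conj_vecD V) (_ : conj_vec 0 = 0)); last first.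
    by rewrite /conj_vec /= oppr0.
  apply: memv_suml => i _; rewrite conj_vecZ memvZ // XT //.
  by rewrite mem_nth.
apply/idP/idP => [|zS].
  apply: conj_span => _ /mapP[y yS ->].
  by rewrite conj_vecK vbasis_mem.
rewrite -[z]conj_vecK; move: zS; rewrite -{1}(span_basis (vbasisP S)).
by apply: conj_span => y yS; rewrite memv_span ?map_f.
Qed.

End Maps.
End Complexification.

Notation dual V := 'Hom(V, (_)^o).
(* V + V^* *)
Notation bigT V := (V * dual V)%type.

Section Duality.
Variable R : rcfType.
Implicit Types U V W : vectType R.

Definition transpose V W (f : 'Hom(V, W)) : 'Hom(dual W, dual V) :=
  linfun (fun eta : dual W => (eta \o f)%VF).

Definition evalv V : 'Hom(V, dual (dual V)) :=
  linfun (fun X : V => linfun (fun alpha : dual V => alpha X)).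

Definition ann V (S : {vspace V}) : {vspace dual V} :=
  (\bigcap_(X <- vbasis S) lker (evalv V X))%VS.

(* The annihilator in V of a subspace of the dual. *)
Definition coann V (T : {vspace dual V}) : {vspace V} :=
  (\bigcap_(alpha <- vbasis T) lker alpha)%VS.

(* Bilinear forms on U in curried form. *)
Definition alternating U (b : 'Hom(U, dual U)) := forall x, b x x = 0.

(* Wedge^2 V is the space of alternating forms on V^*, Wedge^2 V^* that of
   alternating forms on V, so flat_sigma is sigma itself, while sharp_pi alpha
   is the vector of V that corresponds to pi(alpha, -) under V = V^**. *)
Definition sharp V (pi : 'Hom(dual V, dual (dual V))) : 'Hom(dual V, V) :=
  ((evalv V)^-1 \o pi)%VF.

Definition flat V (sigma : 'Hom(V, dual V)) : 'Hom(V, dual V) := sigma.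

Lemma transposeE V W (f : 'Hom(V, W)) (eta : dual W) (X : V) :
  transpose f eta X = eta (f X).
Proof.
have lin : linear (fun eta : dual W => (eta \o f)%VF : dual V).
  by move=> a u v; rewrite comp_lfunDl comp_lfunZl.
pose F := GRing.isLinear.Build _ _ _ _ _ lin.
pose L : {linear dual W -> dual V} := HB.pack (fun eta : dual W => _) F.
by rewrite /transpose (lfunE L) /= lfunE.
Qed.

Lemma evalvE V (X : V) (alpha : dual V) : evalv V X alpha = alpha X.
Proof.
have lin1 (Y : V) : linear (fun b : dual V => b Y : R^o).
  by move=> a u v; rewrite add_lfunE scale_lfunE.
pose F1 Y := GRing.isLinear.Build _ _ _ _ _ (lin1 Y).
pose L1 Y : {linear dual V -> R^o} := HB.pack (fun b : dual V => b Y) (F1 Y).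
have lin2 : linear (fun Y : V => linfun (fun b : dual V => b Y)).
  move=> a u v; apply/lfunP => b.
  rewrite add_lfunE scale_lfunE !(lfunE (L1 _)) /=.
  by rewrite linearP.
pose F2 := GRing.isLinear.Build _ _ _ _ _ lin2.
pose L2 : {linear V -> dual (dual V)} := HB.pack (fun Y : V => _) F2.
by rewrite /evalv (lfunE L2) /= (lfunE (L1 X)).
Qed.

Lemma evalv_inj V : lker (evalv V) == 0%VS.
Proof.
apply/lker0P => X Y e; apply/eqP; rewrite -subr_eq0; apply/eqP.
rewrite (coord_vbasis (memvf (X - Y))); apply: big1 => i _.
pose c : {linear V -> R^o} := coord (vbasis fullv) i.
have := congr1 (fun b : dual (dual V) => b (linfun c)) e.
rewrite !evalvE !lfunE /= => cXY.
by rewrite linearB /= cXY subrr scale0r.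
Qed.

Lemma memv_bigcap_seq V (I : eqType) (s : seq I) (F : I -> {vspace V}) x :
  (x \in \bigcap_(i <- s) F i)%VS = all (fun i => x \in F i) s.
Proof.
elim: s => [|i s IHs]; first by rewrite big_nil memvf.
by rewrite big_cons memv_cap IHs.
Qed.

Lemma sharpE V (pi : 'Hom(dual V, dual (dual V))) (alpha beta : dual V) :
  beta (sharp pi alpha) = pi alpha beta.
Proof.
rewrite /sharp lfunE /= -evalvE limg_lfunVK //.
suff -> : limg (evalv V) = fullv by rewrite memvf.
apply/eqP; rewrite eqEdim subvf /= limg_dim_eq.
  by rewrite !dimvf /dim /= /dim /= !muln1.
by apply/eqP; rewrite capfv evalv_inj.
Qed.

Lemma annP V (S : {vspace V}) (alpha : dual V) :
  reflect {in S, forall X, alpha X = 0} (alpha \in ann S).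
Proof.
rewrite memv_bigcap_seq.
apply: (iffP allP) => [h X /coord_vbasis ->|h X /vbasis_mem SX].
  rewrite linear_sum big1 //= => i _; rewrite linearZ /=.
  have /h : (vbasis S)`_i \in vbasis S by rewrite mem_nth ?size_tuple.
  by rewrite memv_ker evalvE => /eqP ->; rewrite scaler0.
by rewrite memv_ker evalvE h.
Qed.

Lemma coannP V (T : {vspace dual V}) (X : V) :
  reflect {in T, forall alpha : dual V, alpha X = 0} (X \in coann T).
Proof.
rewrite memv_bigcap_seq.
apply: (iffP allP) => [h alpha /coord_vbasis ->|h alpha /vbasis_mem Ta].
  rewrite sum_lfunE big1 //= => i _; rewrite scale_lfunE.
  have /h : (vbasis T)`_i \in vbasis T by rewrite mem_nth ?size_tuple.
  by rewrite memv_ker => /eqP ->; rewrite scaler0.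
by rewrite memv_ker h.
Qed.

(* The identification of W^* with ann (ker f). *)
Lemma limg_transpose V W (f : 'Hom(V, W)) :
  limg (transpose f) = ann (lker f).
Proof.
apply/eqP; rewrite eqEsubv; apply/andP; split; apply/subvP => alpha.
  case/memv_imgP => eta _ ->; apply/annP => X; rewrite memv_ker => /eqP fX.
  by rewrite transposeE fX linear0.
move/annP => alpha0; apply/memv_imgP; exists (alpha \o f^-1)%VF; rewrite ?memvf //.
apply/lfunP => X; rewrite transposeE lfunE /=; apply/eqP.
rewrite -subr_eq0 -linearB /= alpha0 // memv_ker linearB /=.
by rewrite limg_lfunVK ?subrr // memv_img ?memvf.
Qed.

Lemma transpose_inj V W (f : 'Hom(V, W)) :
  limg f = fullv -> lker (transpose f) == 0%VS.
Proof.
move=> surjf; apply/lker0P => eta eta' e; apply/lfunP => Y.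
have /memv_imgP[X _ ->] : Y \in limg f by rewrite surjf memvf.
by rewrite -!transposeE e.
Qed.

End Duality.

Section GeneralizedComplex.
Variable R : rcfType.
Implicit Types V W : vectType R.

Definition neutral_metric V (x y : bigT V) : R :=
  2^-1 * (x.2 y.1 + y.2 x.1).

Definition gen_complex V (J : 'End(bigT V)) :=
  (J \o J)%VF = - \1%VF /\
  forall x y, neutral_metric x (J y) + neutral_metric (J x) y = 0.

Definition classical_tensors V (J : 'End(bigT V)) (A : 'End(V))
    (pi : 'Hom(dual V, dual (dual V))) (sigma : 'Hom(V, dual V)) :=
  [/\ alternating pi, alternating sigma &
      forall X alpha, J (X, alpha) =
        (A X + sharp pi alpha, flat sigma X - transpose A alpha)].

Definition ieigenspace V (J : 'End(bigT V)) :
    {vspace complexification (bigT V)} :=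
  passmx.leigenspace (complexify J) 'i%C.

(* The push-forward { (f X, eta) | (X, f^* eta) \in S } is the image under
   (X, eta) |-> (f X, eta) of the preimage of S under
   (X, eta) |-> (X, f^* eta); see mem_pushforward. *)
Definition push_source V W (f : 'Hom(V, W)) : 'Hom((V * dual W)%type, bigT V) :=
  linfun (fun p : V * dual W => (p.1, transpose f p.2)).

Definition push_target V W (f : 'Hom(V, W)) : 'Hom((V * dual W)%type, bigT W) :=
  linfun (fun p : V * dual W => (f p.1, p.2)).

Definition pushforward V W (f : 'Hom(V, W))
    (S : {vspace complexification (bigT V)}) :
    {vspace complexification (bigT W)} :=
  (complexify (push_target f) @: (complexify (push_source f) @^-1: S))%VS.

Definition projected_structure V W (f : 'Hom(V, W)) (J : 'End(bigT V))
    (Jt : 'End(bigT W)) :=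
  [/\ (pushforward f (ieigenspace J)
         :&: pushforward f (conj_space (ieigenspace J)) = 0)%VS,
      gen_complex Jt & ieigenspace Jt = pushforward f (ieigenspace J)].

(* B = V + W^*, where W^* = ann (ker f). *)
Definition Bspace V W (f : 'Hom(V, W)) : {vspace bigT V} :=
  (linfun snd @^-1: ann (lker f))%VS.

(* The projection B -> B / ker f = W + W^*; only its values on Bspace f are
   meaningful, since (transpose f)^-1 inverts transpose f on ann (ker f). *)
Definition q V W (f : 'Hom(V, W)) (x : bigT V) : bigT W :=
  (f x.1, (transpose f)^-1%VF x.2).

Lemma push_sourceE V W (f : 'Hom(V, W)) X eta :
  push_source f (X, eta) = (X, transpose f eta).
Proof.
have lin : linear (fun p : V * dual W => (p.1, transpose f p.2) : bigT V).
  by move=> a u v; rewrite /= linearP.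
pose F := GRing.isLinear.Build _ _ _ _ _ lin.
pose L : {linear (V * dual W)%type -> bigT V} :=
  HB.pack (fun p : V * dual W => _) F.
by rewrite /push_source (lfunE L).
Qed.

Lemma push_targetE V W (f : 'Hom(V, W)) X eta :
  push_target f (X, eta) = (f X, eta).
Proof.
have lin : linear (fun p : V * dual W => (f p.1, p.2) : bigT W).
  by move=> a u v; rewrite /= linearP.
pose F := GRing.isLinear.Build _ _ _ _ _ lin.
pose L : {linear (V * dual W)%type -> bigT W} :=
  HB.pack (fun p : V * dual W => _) F.
by rewrite /push_target (lfunE L).
Qed.

Lemma mem_Bspace V W (f : 'Hom(V, W)) X alpha :
  ((X, alpha) \in Bspace f) = (alpha \in ann (lker f)).
Proof. by rewrite -memv_preim lfunE. Qed.

Lemma qE V W (f : 'Hom(V, W)) X eta :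
  limg f = fullv -> q f (X, transpose f eta) = (f X, eta).
Proof. by move=> /transpose_inj injf; rewrite /q /= lker0_lfunK. Qed.

(* (X1, eta1) + i (X2, eta2) ranges over V^c + (W^* )^c. *)
Lemma mem_pushforward V W (f : 'Hom(V, W))
    (S : {vspace complexification (bigT V)}) (z : complexification (bigT W)) :
  reflect (exists X1 X2 eta1 eta2,
     (((X1, transpose f eta1), (X2, transpose f eta2))
        : complexification (bigT V)) \in S /\
     z = ((f X1, eta1), (f X2, eta2)))
    (z \in pushforward f S).
Proof.
apply: (iffP memv_imgP) => [[[[X1 eta1] [X2 eta2]]]|].
  rewrite -memv_preim !complexifyE /= !push_sourceE !push_targetE => Sz ->.
  by exists X1, X2, eta1, eta2.
move=> [X1 [X2 [eta1 [eta2 [Sz ->]]]]].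
exists ((X1, eta1), (X2, eta2)).
  by rewrite -memv_preim complexifyE /= !push_sourceE.
by rewrite complexifyE /= !push_targetE.
Qed.

Lemma mem_ieigenspace V (J : 'End(bigT V)) (x y : bigT V) :
  (((x, y) : complexification (bigT V)) \in ieigenspace J) = (J x == - y) && (J y == x).
Proof.
rewrite /ieigenspace /passmx.leigenspace memv_ker.
rewrite add_lfunE opp_lfunE scale_lfunE id_lfunE subr_eq0 complexifyE.
by rewrite complexification_scaleE /= !scale0r !scale1r sub0r add0r xpair_eqE.
Qed.

End GeneralizedComplex.

(* Main.v *)
Require Import Defs.
From HB Require Import structures.
From mathcomp Require Import all_boot all_order all_algebra.
From mathcomp Require Import reals.

Set Implicit Arguments.
Unset Strict Implicit.
Unset Printing Implicit Defensive.

Import GRing.Theory.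
Local Open Scope ring_scope.

(** The projected structure is determined by the subspace of those [b] in
    [B] with [J b] in [B].  Indeed, an [i]-eigenvector of [J] has the form
    [b - i J b] with [b] real, and it lies in the complexification of [B]
    exactly when [b] and [J b] both lie in [B].  Since the [i]-eigenspace of
    [Jt] is the push-forward of that of [J], this gives two facts:
    - if [b] and [J b] lie in [B], then [Jt (q b) = q (J b)]
      ([projected_structure_q]);
    - conversely, every [w - i Jt w] comes from such a [b], so every [w] is
      [q b] for some [b] with [b] and [J b] in [B]
      ([projected_structure_lift]).
    As the kernel of [q] on [B] is [ker f], the second fact says that any
    element of [B] can be moved by a vector of [ker f] so that its image under
    [J] falls in [B] ([projected_structure_correct]).  All three
    decompositions come from this correction, applied to [(0, alpha)],
    [(X, 0)] and [(X, alpha)] respectively.  Both formulas for [Jt] then come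
    from the first fact: [(U + Z, alpha)] and [(X, alpha) - (Z0, 0)] are
    corrections of [(X, alpha)], so they have the same projection under [q]. *)

Lemma gen_complexK (R : rcfType) (U : vectType R) (J : 'End(bigT U))
    (x : bigT U) :
  gen_complex J -> J (J x) = - x.
Proof.
by case=> /lfunP/(_ x); rewrite comp_lfunE opp_lfunE id_lfunE.
Qed.

Lemma mem_ieigenspace_graph (R : rcfType) (U : vectType R) (J : 'End(bigT U))
    (x : bigT U) :
  gen_complex J ->
  ((x, - J x) : complexification (bigT U)) \in ieigenspace J.
Proof.
move=> gcJ.
by rewrite mem_ieigenspace (linearN J) /= gen_complexK // !opprK !eqxx.
Qed.

Section ProjectedStructure.
Variables (R : rcfType) (V W : vectType R) (f : 'Hom(V, W)).
Hypothesis surjf : limg f = fullv.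

Lemma BspaceP (x : bigT V) :
  reflect (exists X eta, x = (X, transpose f eta)) (x \in Bspace f).
Proof.
case: x => X alpha; rewrite mem_Bspace -limg_transpose.
apply: (iffP memv_imgP) => [[eta _ ->]|[Y [eta [_ ->]]]].
  by exists X, eta.
by exists eta; rewrite ?memvf.
Qed.

Lemma Bspace_ker (Z : V) : (Z, 0) \in Bspace f.
Proof. by rewrite mem_Bspace mem0v. Qed.

Lemma q_mod_ker (x y : bigT V) :
  x.1 - y.1 \in lker f -> x.2 = y.2 -> q f x = q f y.
Proof.
by rewrite memv_ker linearB /= subr_eq0 /q => /eqP -> ->.
Qed.

Lemma q_eq_mod_ker (x y : bigT V) : x \in Bspace f -> y \in Bspace f ->
  q f x = q f y -> exists2 Z, Z \in lker f & x - (Z, 0) = y.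
Proof.
move=> /BspaceP[X [eta ->]] /BspaceP[Y [mu ->]].
rewrite !qE // => -[eXY ->]; exists (X - Y).
  by rewrite memv_ker linearB /= eXY subrr.
by apply/pair_eqP; rewrite /= subr0 subKr !eqxx.
Qed.

Variables (J : 'End(bigT V)) (Jt : 'End(bigT W)).
Hypotheses (gcJ : gen_complex J) (projJ : projected_structure f J Jt).

(** The vector [b - i J b] lies in the [i]-eigenspace of [J] and in the
    complexification of [B], so its projection is an [i]-eigenvector of
    [Jt]. *)
Lemma projected_structure_q (b : bigT V) :
  b \in Bspace f -> J b \in Bspace f -> Jt (q f b) = q f (J b).
Proof.
case: projJ => _ _ eigJt /BspaceP[X [eta eb]] /BspaceP[Y [mu eJb]].
have: ((q f b, - q f (J b)) : complexification (bigT W)) \in ieigenspace Jt.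
  rewrite eigJt; apply/mem_pushforward; exists X, (- Y), eta, (- mu).
  split; last by rewrite eJb eb !qE // (linearN f) /=.
  have -> : (- Y, transpose f (- mu)) = - J b.
    by rewrite eJb (linearN (transpose f)).
  by rewrite -eb mem_ieigenspace_graph.
by rewrite mem_ieigenspace opprK => /andP[/eqP].
Qed.

(** The [i]-eigenvector [w - i Jt w] of [Jt] is the projection of an
    [i]-eigenvector of [J] in the complexification of [B], whose real part is
    the desired [b]. *)
Lemma projected_structure_lift (w : bigT W) :
  exists b : bigT V, [/\ b \in Bspace f, J b \in Bspace f & q f b = w].
Proof.
case: projJ => _ gcJt eigJt.
have := mem_ieigenspace_graph w gcJt; rewrite eigJt.
move=> /mem_pushforward[X1 [X2 [eta1 [eta2 [+ [-> _]]]]]].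
rewrite mem_ieigenspace => /andP[/eqP eJ _].
exists (X1, transpose f eta1); rewrite eJ memvN qE //.
by split=> //; apply/BspaceP; [exists X1, eta1|exists X2, eta2].
Qed.

(** The projection does not see [ker f], so a lift of [q x] differs from [x]
    by a vector of [ker f]. *)
Lemma projected_structure_correct (x : bigT V) : x \in Bspace f ->
  exists2 Z, Z \in lker f & J (x - (Z, 0)) \in Bspace f.
Proof.
move=> xB; have [b [bB JbB /esym qb]] := projected_structure_lift (q f x).
by have [Z Zker eb] := q_eq_mod_ker xB bB qb; exists Z; rewrite ?eb.
Qed.

End ProjectedStructure.

(** An alternating form is skew-symmetric, so the annihilator of
    [flat sigma (S)] in [V] is the [sigma]-orthogonal of [S], which can be
    tested with either argument in [S]. *)
Lemma mem_coann_flat (R : rcfType) (V : vectType R)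
    (sigma : 'Hom(V, dual V)) (S : {vspace V}) (U : V) :
  alternating sigma ->
  (U \in coann (flat sigma @: S)%VS) = (flat sigma U \in ann S).
Proof.
move=> alt.
have skew x y : sigma x y = - sigma y x.
  have := alt (x + y).
  rewrite (linearD sigma) /= add_lfunE !linearD /= !alt add0r addr0.
  by move/eqP; rewrite addr_eq0 => /eqP.
apply/coannP/annP => [h Y SY|h _ /memv_imgP[Y SY ->]].
  by rewrite /flat skew (h (sigma Y)) ?oppr0 // memv_img.
by rewrite skew h ?oppr0.
Qed.

Theorem proposition3p4 (R : realType) (V W : vectType R)
  (J : 'End(bigT V)) (A : 'End(V))
  (pi : 'Hom(dual V, dual (dual V))) (sigma : 'Hom(V, dual V))
  (f : 'Hom(V, W)) (Jt : 'End(bigT W)) :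
  gen_complex J ->
  classical_tensors J A pi sigma ->
  limg f = fullv ->
  projected_structure f J Jt ->
  forall (X : V) (alpha : dual V), (X, alpha) \in Bspace f ->
  [/\ (exists (Z : V) (nu : dual V),
         [/\ Z \in lker f, nu \in ann (lker f) &
             transpose A alpha = flat sigma Z + nu])
      /\
      (exists Z' U : V,
         [/\ Z' \in lker f, U \in coann (flat sigma @: lker f)%VS &
             X = Z' + U])
      /\
      (exists (X' : bigT V) (Z0 : V),
         [/\ X' \in Bspace f, Z0 \in lker f &
             J (X, alpha) = X' + J (Z0, 0)]),
      (forall (Z Z' U : V) (nu : dual V),
         Z \in lker f -> Z' \in lker f ->
         U \in coann (flat sigma @: lker f)%VS -> nu \in ann (lker f) ->
         transpose A alpha = flat sigma Z + nu ->
         X = Z' + U ->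
         J (U + Z, alpha) \in Bspace f /\
         Jt (q f (X, alpha)) = q f (J (U + Z, alpha)))
    & (forall (X' : bigT V) (Z0 : V),
         X' \in Bspace f -> Z0 \in lker f ->
         J (X, alpha) = X' + J (Z0, 0) ->
         [/\ J ((X, alpha) - (Z0, 0)) \in Bspace f,
             Jt (q f (X, alpha)) = q f X' &
             q f X' = q f (J ((X, alpha) - (Z0, 0)))])].
Proof.
move=> gcJ [_ alt JE] surjf projJ X alpha XB.
have alphaB : alpha \in ann (lker f) by rewrite -(mem_Bspace f X).
have JB Y beta : (J (Y, beta) \in Bspace f) =
    (flat sigma Y - transpose A beta \in ann (lker f)).
  by rewrite JE mem_Bspace.
have correct := projected_structure_correct surjf projJ.
have JtE := projected_structure_q surjf gcJ projJ.
split; [split; last split| |].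
- have [|Z Zker] := correct (0, alpha); first by rewrite mem_Bspace.
  rewrite JB /= subr0 sub0r => nuB.
  exists (- Z), (transpose A alpha - flat sigma (- Z)); split.
  + by rewrite memvN.
  + by rewrite -opprB memvN.
  + by rewrite addrC subrK.
- have [|Z Zker] := correct (X, 0); first exact: Bspace_ker.
  rewrite JB /= subr0 linear0 subr0 => UB.
  by exists Z, (X - Z); rewrite mem_coann_flat // [Z + _]addrC subrK.
- have [Z Zker JxB] := correct (X, alpha) XB.
  by exists (J ((X, alpha) - (Z, 0))), Z; rewrite -linearD /= subrK.
- move=> Z Z' U nu Zker Z'ker; rewrite mem_coann_flat // => UB nuB eA eX.
  (* The covector part of J (U + Z, alpha) is flat U - nu: adding Z cancels
     the part of A^* alpha outside ann (ker f). *)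
  have JUZ : J (U + Z, alpha) \in Bspace f.
    by rewrite JB eA linearD /= opprD addrA addrK memvB.
  split=> //; rewrite -JtE ?mem_Bspace //; congr (Jt _); apply: q_mod_ker => //=.
  by rewrite eX addrKA memvB.
- move=> X' Z0 X'B Z0ker eJ.
  have eX' : J ((X, alpha) - (Z0, 0)) = X' by rewrite linearB /= eJ addrK.
  rewrite eX'; split=> //; rewrite -eX' -JtE ?eX' ?rpredB ?Bspace_ker //.
  by congr (Jt _); apply: q_mod_ker; rewrite /= ?subr0 ?subKr.
Qed.
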